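(* Let $\kappa$ be a regular uncountable cardinal, $\sigma<\nu<\xi\le\kappa$ infinite cardinals, $S\subseteq E^\kappa_{>\nu}$ and $T\subseteq\kappa$ stationary sets, and $\vec J=\langle J_\delta\mid\delta\in S\rangle$ where each $J_\delta$ is a $\mathrm{cf}(\delta)$-additive proper ideal over $\delta$ extending $J^{\mathrm{bd}}[\delta]$. Then: (1) if $\mathrm{CG}_\xi(S,E^\kappa_\sigma\cap\mathrm{Tr}(T),1,\vec J)$ holds, then so does $\mathrm{CG}_\xi(S,T,\sigma,\vec J)$; (2) if $\mathrm{CG}_\xi(S,E^\kappa_\nu\cap\mathrm{Tr}(T),1,\vec J)$ holds, then so does $\mathrm{CG}_\xi(S,T,\sigma,\vec J)$.
   Context: $E^\kappa_\mu=\{\alpha<\kappa\mid\mathrm{cf}(\alpha)=\mu\}$, $E^\kappa_{>\nu}=\{\alpha<\kappa\mid\mathrm{cf}(\alpha)>\nu\}$. $\mathrm{Tr}(T)=\{\alpha\in E^\kappa_{>\omega}\mid T\cap\alpha\text{ is stationary in }\alpha\}$. A $C$-sequence over $S$ is $\langle C_\delta\mid\delta\in S\rangle$ with each $C_\delta$ a closed subset of $\delta$ with $\sup(C_\delta)=\delta$; $\xi$-bounded means $\mathrm{otp}(C_\delta)\le\xi$. $\mathrm{suc}_\sigma(C)=\{C(j+1)\mid j<\sigma,\ j+1<\mathrm{otp}(C)\}$, $C(i)$ the $i$-th element of $C$. $J^{\mathrm{bd}}[\delta]$ is the ideal of bounded subsets of $\delta$; $J^+=\mathcal P(\delta)\setminus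 J$. For $T'\subseteq\kappa$ and ordinal $\sigma$, $\mathrm{CG}_\xi(S,T',\sigma,\vec J)$ asserts the existence of a $\xi$-bounded $C$-sequence $\langle C_\delta\mid\delta\in S\rangle$ such that for every club $D\subseteq\kappa$ there is $\delta\in S$ with $\{\beta<\delta\mid\mathrm{suc}_\sigma(C_\delta\setminus\beta)\subseteq D\cap T'\}\in J_\delta^+$. *)

(* Defs.v *)
From mathcomp Require Import all_boot all_order.
From mathcomp Require Import boolp classical_sets functions cardinality.

Set Implicit Arguments.
Unset Strict Implicit.
Unset Printing Implicit Defensive.

Local Open Scope order_scope.
Local Open Scope classical_set_scope.
Local Open Scope card_scope.

(* The cardinal kappa is a well-ordered type K.  An ordinal alpha < kappa is a
   point of K; in the style of von Neumann, any ordinal alpha <= kappa is also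
   represented by the initial segment of K of the ordinals below it: seg alpha
   for alpha < kappa, and [set: K] for kappa itself.  On initial segments,
   alpha <= beta is `<=`, alpha < beta is `<` (proper inclusion), and the
   supremum of a set of ordinals is the union of its elements.  Arguments named
   I, m, o, xi, sigma are meant to be such initial segments. *)
Section ClubGuessing.
Context {d : Order.disp_t} {K : orderType d}.
Implicit Types (a b x y i j : K) (A C D S T I m o xi sigma : set K).

Definition seg a : set K := [set x | x < a].

Definition is_ordinal I : Prop := forall x y, x < y -> I y -> I x.

Definition ord_one : set K := [set x | forall y, x <= y].

Definition ord_omega : set K := [set x | finite_set (seg x)].

Definition osup A : set K := \bigcup_(x in A) seg x.

Definition is_succ x y : Prop := x < y /\ forall z, x < z -> y <= z.

Definition enumerates o A (f : K -> K) : Prop :=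
  [/\ is_ordinal o,
      forall i j, o i -> o j -> i < j -> f i < f j
    & f @` o = A].

Definition has_otp A o : Prop := exists f, enumerates o A f.

Definition is_cardinal I : Prop :=
  is_ordinal I /\ forall a, I a -> ~ (I #<= seg a).

Definition infinite_cardinal I : Prop := is_cardinal I /\ infinite_set I.

(* The non-strict inequality gives a successor ordinal cofinality 1. *)
Definition cofinal_in I A : Prop :=
  A `<=` I /\ forall b, I b -> exists2 x, A x & b <= x.

Definition has_cf I m : Prop :=
  (exists A, cofinal_in I A /\ has_otp A m) /\
  (forall A o, cofinal_in I A -> has_otp A o -> m `<=` o).

Definition E_cf m : set K := [set a | has_cf (seg a) m].

Definition E_cf_gt m : set K := [set a | exists2 m', has_cf (seg a) m' & m `<` m'].

Definition closed_in I C : Prop :=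
  C `<=` I /\
  forall g, I g -> seg g !=set0 -> osup (C `&` seg g) = seg g -> C g.

Definition club_in I C : Prop := closed_in I C /\ osup C = I.

Definition stationary_in I S : Prop :=
  S `<=` I /\ forall D, club_in I D -> (S `&` D) !=set0.

Definition Tr T : set K :=
  [set a | E_cf_gt ord_omega a /\ stationary_in (seg a) (T `&` seg a)].

Definition bounded_ideal a : set (set K) :=
  [set A | A `<=` seg a /\ osup A `<` seg a].

Definition proper_ideal a (J : set (set K)) : Prop :=
  [/\ forall A, J A -> A `<=` seg a,
      J set0,
      forall A B : set K, J B -> A `<=` B -> J A,
      forall A B : set K, J A -> J B -> J (A `|` B)
    & ~ J (seg a)].

(* Closure under unions of fewer than |m| members. *)
Definition additive m (J : set (set K)) : Prop :=
  forall F : set (set K), F `<=` J -> F #<= m -> ~ (m #<= F) ->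
    J (\bigcup_(A in F) A).

Definition positive a (J : set (set K)) : set (set K) :=
  [set A | A `<=` seg a /\ ~ J A].

Definition suc_section sigma C : set K :=
  [set x | exists o f i j,
     [/\ enumerates o C f, sigma i, is_succ i j, o j & x = f j]].

Definition C_sequence S (C : K -> set K) : Prop :=
  forall a, S a -> club_in (seg a) (C a).

Definition seq_bounded xi S (C : K -> set K) : Prop :=
  forall a, S a -> exists2 o, has_otp (C a) o & o `<=` xi.

Definition CG xi S T sigma (J : K -> set (set K)) : Prop :=
  exists C : K -> set K,
    [/\ C_sequence S C, seq_bounded xi S C
      & forall D, club_in [set: K] D ->
          exists2 a, S a &
            positive a (J a)
              [set b | b < a /\ suc_section sigma (C a `\` seg b) `<=` D `&` T]].

End ClubGuessing.

Definition regular_uncountable_cardinal d (K : orderType d) : Prop :=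
  [/\ well_founded (fun x y : K => x < y),
      is_cardinal [set: K],
      has_cf [set: K] [set: K]
    & ~ countable [set: K]].

(* Main.v *)
(* For each g of the relevant cofinality fix a club e_g in g that is small (or
   small below each z < g).  Given the C-sequence of the hypothesis and a club
   D, enlarge C_delta by inserting, below alternate non-accumulation points g
   of C_delta, the points of e_g that lie in D and T, and closing off.  If the
   result fails for every D, iterate: let W(D) be a club on which D fails, and
   D_i the intersection of the W(D_j), j < i.  Apply the hypothesis to the
   limit points of D_nu.  For each g guessed, D_nu, T and e_g meet cofinally in
   g since T reflects at g.  Each i < nu such that some point of D_i, T and a
   fixed piece of e_g of size less than nu is outside W(D_i) determines a
   different such point, so some i < nu has none: the enlargement for D_i then
   succeeds at g.  As nu < cf(delta), additivity makes a single i < nu work for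
   positively many starting points. *)

Require Import Defs.
From mathcomp Require Import all_boot all_order.
From mathcomp Require Import boolp classical_sets functions cardinality.

Set Implicit Arguments.
Unset Strict Implicit.
Unset Printing Implicit Defensive.

Import Order.TTheory.

Local Open Scope order_scope.
Local Open Scope classical_set_scope.
Local Open Scope card_scope.

(** * Well-founded recursion and comparison of cardinalities *)

Lemma wf_recursion (U V : Type) (R : U -> U -> Prop) (wfR : well_founded R)
    (v0 : V) (F : U -> (U -> V) -> V) :
  (forall x g h, (forall y, R y x -> g y = h y) -> F x g = F x h) ->
  exists r : U -> V, forall x, r x = F x r.
Proof.
move=> Fext.
(* [F] expects a total function, so values outside the predecessors of [x] are set to [v0]; by
   [Fext] they do not matter. *)
pose G x (rec : forall y, R y x -> V) :=
  F x (fun y => if pselect (R y x) is left h then rec y h else v0).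
exists (Fix wfR (fun=> V) G) => x.
rewrite Fix_eq => [|y g h gh].
  by apply: Fext => y yx; case: pselect.
by congr (F y _); apply: funext => z; case: pselect => // zy; rewrite gh.
Qed.

Lemma inj_card_leP {U V : Type} {A : set U} {B : set V} (v0 : V) :
  A #<= B <-> exists f : U -> V, (forall x, A x -> B (f x)) /\
                (forall x y, A x -> A y -> f x = f y -> x = y).
Proof.
split=> [|[f [fAB finj]]].
  elim/Ppointed: V => V in B v0 *; first by case: (no v0).
  move=> /pcard_leP/injfunPex[f fAB finj]; exists f; split=> // x y Ax Ay.
  by apply: finj; rewrite inE.
have : f @` A #= A.
  by apply: inj_card_eq => x y; rewrite !inE => Ax Ay; apply: finj.
rewrite card_eq_le => /andP[_ /card_le_trans]; apply; apply: subset_card_le.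
by move=> _ [x /fAB Bfx <-].
Qed.

(** Hilbert's hotel: a shift along a sequence injected into [A] frees its first entry for [x]. *)
Lemma infinite_setU1_card (U : choiceType) (A : set U) (x : U) :
  infinite_set A -> x |` A #<= A.
Proof.
move=> infA; case: (pselect (A x)) => [Ax|nAx].
  by apply: subset_card_le => y [->|].
have [g [gA ginj]] := (inj_card_leP x).1 ((infiniteP A).1 infA).
have {}gA n : A (g n) by apply: gA.
have {}ginj (k l : nat) : g k = g l -> k = l by apply: ginj.
pose N y := xget 0%N [set n | g n = y].
have NP n : N (g n) = n.
  by apply: ginj; apply: (@xgetPex _ 0%N [set k | g k = g n]); exists n.
apply/(inj_card_leP x); exists (fun y =>
  if y == x then g 0%N
  else if `[< range g y >] then g (N y).+1 else y).
split=> [y|y z].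
  case: eqVneq => [//|nyx] [yx|Ay]; first by rewrite yx eqxx in nyx.
  by case: asboolP.
move=> Ay Az; case: eqVneq => [->|nyx]; case: eqVneq => [->|nzx] //.
- case: (asboolP (range g z)) => [_ /ginj//|nz e]; case: nz.
  by exists 0%N.
- case: (asboolP (range g y)) => [_ /ginj//|ny e]; case: ny.
  by exists 0%N.
case: (asboolP (range g y)) => [[k _ <-]|ny];
  case: (asboolP (range g z)) => [[l _ <-]|nz] //.
- by rewrite !NP => /ginj[->].
- by move=> e; case: nz; rewrite -e; exists (N (g k)).+1.
- by move=> e; case: ny; rewrite e; exists (N (g l)).+1.
Qed.

Lemma card_le_setX (U1 U2 V1 V2 : Type) (v1 : V1) (v2 : V2)
    (A1 : set U1) (A2 : set U2) (B1 : set V1) (B2 : set V2) :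
  A1 #<= B1 -> A2 #<= B2 -> A1 `*` A2 #<= B1 `*` B2.
Proof.
move=> /(inj_card_leP v1)[f [fB finj]] /(inj_card_leP v2)[g [gB ginj]].
apply/(inj_card_leP (v1, v2)); exists (fun p => (f p.1, g p.2)).
split=> [[x y] [/= /fB ? /gB ?]//|].
move=> [x y] [x' y'] [/= Ax Ay] [/= Ax' Ay'] [e1 e2].
by congr pair; [apply: finj|apply: ginj].
Qed.

(** * Minima, initial segments and increasing enumerations in a well-order *)

Section WellOrder.
Context {d : Order.disp_t} {K : orderType d}.
Context (wfK : well_founded (fun x y : K => x < y)).
Implicit Types (a b c x y z : K) (A B C I o m : set K).

Lemma wo_ind (P : K -> Prop) :
  (forall x, (forall y, y < x -> P y) -> P x) -> forall x, P x.
Proof. exact: (well_founded_ind wfK). Qed.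

Lemma wo_min A : A !=set0 -> exists2 x, A x & forall y, A y -> x <= y.
Proof.
move=> [x Ax]; apply: contrapT => nomin.
suff : forall y, ~ A y by move/(_ x).
apply: wo_ind => y IH Ay; apply: nomin; exists y => // z Az.
by rewrite leNgt; apply/negP => /IH.
Qed.

Definition wmin x0 A : K := xget x0 [set x | A x /\ forall y, A y -> x <= y].

Lemma wminP x0 A : A !=set0 ->
  A (wmin x0 A) /\ forall y, A y -> wmin x0 A <= y.
Proof.
move=> /wo_min[x Ax xmin].
by apply: (@xgetPex _ x0 [set x | A x /\ forall y, A y -> x <= y]); exists x.
Qed.

Definition nxt A x : K := wmin x [set y | A y /\ x < y].

Lemma nxtP A x : (exists2 y, A y & x < y) ->
  [/\ A (nxt A x), x < nxt A x & forall y, A y -> x < y -> nxt A x <= y].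
Proof.
move=> [y Ay xy].
have [|[Ax xx] mn] := @wminP x [set y | A y /\ x < y]; first by exists y.
by split=> // z Az xz; apply: mn.
Qed.

Lemma seg_ordinal a : is_ordinal (seg a).
Proof. by move=> x y xy ya; apply: lt_trans ya. Qed.

Lemma seg_sub a b : a <= b -> seg a `<=` seg b.
Proof. by move=> ab x xa; apply: lt_le_trans ab. Qed.

Lemma ordinal_sub I x : is_ordinal I -> I x -> seg x `<=` I.
Proof. by move=> oI Ix y yx; apply: oI Ix. Qed.

Lemma ordinal_subN I x : is_ordinal I -> ~ I x -> I `<=` seg x.
Proof.
move=> oI nIx y Iy; rewrite /seg/= ltNge; apply/negP; rewrite le_eqVlt.
by move=> /orP[/eqP xy|/oI/(_ Iy)//]; apply: nIx; rewrite xy.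
Qed.

Lemma ordinal_proper I o : is_ordinal I -> is_ordinal o -> I `<` o ->
  exists2 a, o a & I = seg a.
Proof.
move=> oI oo; rewrite properEneq => -[/eqP nIo Io].
have [|a [oa nIa] amin] := @wo_min (o `\` I).
  apply: contrapT => e; apply: nIo; apply/seteqP; split=> // x ox.
  by apply: contrapT => nIx; apply: e; exists x.
exists a => //; apply/seteqP; split; first exact: ordinal_subN.
move=> x xa; apply: contrapT => nIx.
have := amin x (conj (oo _ _ xa oa) nIx).
by rewrite leNgt xa.
Qed.

(** Mostowski collapse inside [K]: [r x] is the least strict bound of the [r z] for earlier [z] in
    [A], and the inverse of [r] is the enumeration. *)
Lemma enum_exists A : exists o f, enumerates o A f.
Proof.
case: (pselect (exists x0 : K, True)) => [[x0 _]|K0]; last first.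
  exists set0, id; split=> //; apply/seteqP; split=> x; first by case=> ? [].
  by case: K0; exists x.
have [|r rE] := @wf_recursion _ _ _ wfK x0 (fun x r =>
    wmin x [set y | forall z, A z -> z < x -> r z < y]).
  move=> x g h gh; congr wmin; apply/seteqP; split=> y /= H z Az zx.
    by rewrite -gh// H.
  by rewrite gh// H.
(* The bound [r x <= x] is carried along the induction because it makes the minimised set nonempty:
   it contains [x]. *)
have rP x : (forall z, A z -> z < x -> r z < r x) /\
    (forall y, (forall z, A z -> z < x -> r z < y) -> r x <= y) /\ r x <= x.
  move: x; apply: wo_ind => x IH.
  have H : forall z, A z -> z < x -> r z < x.
    by move=> z Az zx; apply: (le_lt_trans _ zx); apply: (IH z zx).2.2.
  have := @wminP x [set y | forall z, A z -> z < x -> r z < y].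
  case; first by exists x.
  by rewrite -rE => h1 h2; split=> //; split; [exact: h2|exact: h2].
have rmono x y : A x -> A y -> r x < r y -> x < y.
  move=> Ax Ay; apply: contraTT; rewrite -!leNgt le_eqVlt => /orP[/eqP->//|yx].
  exact/ltW/(rP x).1.
have rinj x y : A x -> A y -> r x = r y -> x = y.
  move=> Ax Ay e; case: (ltgtP x y) => // /(rP _).1 => [/(_ Ax)|/(_ Ay)];
  by rewrite e ltxx.
(* A value below [r x] that is not attained would bound all earlier values, so [r x] would be at
   most that value. *)
have oI : is_ordinal (r @` A).
  move=> y y' yy' [x Ax e]; move: y' e yy' => _ <-; move: x Ax.
  apply: wo_ind => x IH Ax yx; apply: contrapT => ny.
  have : r x <= y.
    apply: (rP x).2.1 => z Az zx; rewrite ltNge le_eqVlt; apply/negP => /orP[].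
      by move=> /eqP e; apply: ny; exists z.
    by move=> yz; apply: ny; apply: (IH z).
  by rewrite leNgt yx.
pose f y := xget y [set x | A x /\ r x = y].
have fP y : (r @` A) y -> A (f y) /\ r (f y) = y.
  by move=> [x Ax xy]; apply: (@xgetPex _ y [set x | A x /\ r x = y]); exists x.
exists (r @` A), f; split=> //.
  move=> i j /fP[Ai ri] /fP[Aj rj] ij; apply: rmono => //.
  by rewrite ri rj.
apply/seteqP; split=> [_ [y /fP[Af _] <-]//|x Ax].
exists (r x); first by exists x.
have [|Af rf] := fP (r x); first by exists x.
exact: rinj.
Qed.

Section Enumeration.
Context {o A : set K} {f : K -> K}.
Context (enf : enumerates o A f).

Lemma enum_ordinal : is_ordinal o. Proof. by case: enf. Qed.

Lemma enum_mem i : o i -> A (f i).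
Proof. by move=> oi; case: enf => _ _ <-; exists i. Qed.

Lemma enum_surj x : A x -> exists2 i, o i & f i = x.
Proof. by case: enf => _ _ <-. Qed.

Lemma enum_lt i j : o i -> o j -> (f i < f j) = (i < j).
Proof.
case: enf => _ fm _ oi oj; case: (ltgtP i j) => [/fm->//|/fm h|->].
- by apply/negbTE; rewrite -leNgt; apply/ltW/h.
- by rewrite ltxx.
Qed.

Lemma enum_inj i j : o i -> o j -> f i = f j -> i = j.
Proof.
move=> oi oj e; case: (ltgtP i j) => //; rewrite -enum_lt// e ltxx//.
Qed.

Lemma enum_card : o #= A.
Proof.
case: enf => _ _ <-; apply/card_esym/inj_card_eq => x y.
by rewrite !inE; apply: enum_inj.
Qed.

Lemma enum_seg_card i : o i -> seg i #= A `&` seg (f i).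
Proof.
move=> oi; have oi' := ordinal_sub enum_ordinal oi.
suff -> : A `&` seg (f i) = f @` seg i.
  apply/card_esym/inj_card_eq => x y.
  by rewrite !inE => /oi' ? /oi' ?; apply: enum_inj.
apply/seteqP; split=> [x [/enum_surj[j oj <-]]|_ [j ji <-]].
  by rewrite /seg/= enum_lt// => ji; exists j.
split; first exact/enum_mem/oi'.
by rewrite /seg/= enum_lt//; apply: oi'.
Qed.

Lemma enum_ge i : o i -> i <= f i.
Proof.
move: i; apply: wo_ind => i IH oi; rewrite leNgt; apply/negP => fi.
have ofi := enum_ordinal fi oi.
by have := IH _ fi ofi; rewrite leNgt enum_lt// fi.
Qed.

End Enumeration.

(** * Squares of infinite cardinals *)

(* Goedel's well-order of pairs: in each initial segment both coordinates are
   bounded by the larger coordinate of the pair that ends it. *)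
Definition pair_lt (p q : K * K) : Prop :=
  let a := Order.max p.1 p.2 in let b := Order.max q.1 q.2 in
  a < b \/ a = b /\ (p.1 < q.1 \/ p.1 = q.1 /\ p.2 < q.2).

Lemma pair_lt_wf : well_founded pair_lt.
Proof.
suff H a b c p : Order.max p.1 p.2 = a -> p.1 = b -> p.2 = c -> Acc pair_lt p.
  by move=> p; exact: H.
move: a b c p; apply: wo_ind => a IHa; apply: wo_ind => b IHb.
apply: wo_ind => c IHc p pa pb pc; constructor => q.
rewrite /pair_lt pa pb pc => -[qa|[qa [qb|[qb qc]]]].
- exact: IHa qa _ _ _ erefl erefl erefl.
- exact: IHb qb _ _ qa erefl erefl.
- exact: IHc qc _ qa qb erefl.
Qed.

Lemma pair_lt_max p q : pair_lt p q -> Order.max p.1 p.2 <= Order.max q.1 q.2.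
Proof. by case=> [/ltW//|[-> _]]. Qed.

Lemma pair_lt_total p q : p = q \/ pair_lt p q \/ pair_lt q p.
Proof.
rewrite /pair_lt; case: p q => [p1 p2] [q1 q2] /=.
case: (ltgtP (Order.max p1 p2) (Order.max q1 q2)) => [h|h|e].
- by right; left; left.
- by right; right; left.
case: (ltgtP p1 q1) e => [h|h|->] e.
- by right; left; right; split=> //; left.
- by right; right; right; split=> //; left.
case: (ltgtP p2 q2) => [h|h|->]; last by left.
- by right; left; right; split=> //; right.
- by right; right; right; split=> //; right.
Qed.

(** Hessenberg's theorem. If no smaller segment has the size of [seg b], the pairs preceding a given
    pair are too few to exhaust [seg b], so each pair can be sent to the least value not yet
    taken. *)
Lemma seg_square_card b : infinite_set (seg b) -> seg b `*` seg b #<= seg b.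
Proof.
move: b; apply: wo_ind => b IH infb.
case: (pselect (exists2 c, c < b & seg b #<= seg c)) => [[c cb bc]|bcard].
  have infc : infinite_set (seg c) by move=> /(card_le_finite bc).
  apply: (card_le_trans (card_le_setX b b bc bc)).
  apply: (card_le_trans (IH c cb infc)).
  exact/subset_card_le/seg_sub/ltW.
have [|r rE] := @wf_recursion _ _ _ pair_lt_wf b (fun p r =>
    wmin b (~` (r @` [set q | pair_lt q p]))).
  move=> p g h gh; congr (wmin _ (~` _)); apply: eq_imagel => q; exact: gh.
have rP p : seg b p.1 -> seg b p.2 ->
    r p < b /\ forall q, pair_lt q p -> r q <> r p.
  move=> p1b p2b; set m := Order.max p.1 p.2.
  have mb : m < b by rewrite /m; case: (leP p.1 p.2).
  pose L := m |` seg m.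
  have LE : [set q | pair_lt q p] `<=` L `*` L.
    have inL x : x <= m -> L x.
      by rewrite le_eqVlt => /orP[/eqP->|]; [left|right].
    move=> q /pair_lt_max qp; split; apply: inL; apply: le_trans qp.
      by rewrite le_max lexx.
    by rewrite le_max lexx orbT.
  have [z zb nz] : exists2 z, z < b & ~ (r @` [set q | pair_lt q p]) z.
    apply: contrapT => H.
    have bL : seg b #<= L `*` L.
      apply: (@card_le_trans _ _ _ (r @` [set q | pair_lt q p])).
        apply: subset_card_le => z zb.
        by apply: contrapT => nz; apply: H; exists z.
      by apply: (card_le_trans (card_image_le _ _)); apply: subset_card_le.
    have [finm|infm] := pselect (finite_set (seg m)).
      have finL : finite_set L.
        by rewrite finite_setU; split=> //; exact: finite_set1.
      by apply/infb/(card_le_finite bL)/finite_setX.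
    apply: bcard; exists m => //; apply: (card_le_trans bL).
    have Lm := infinite_setU1_card m infm.
    by apply: (card_le_trans (card_le_setX m m Lm Lm)); apply: IH.
  have [|nr rmin] := @wminP b (~` (r @` [set q | pair_lt q p])); first by exists z.
  rewrite -rE in nr rmin; split; first by apply: le_lt_trans zb; exact: rmin.
  by move=> q qp e; apply: nr; exists q.
apply/(inj_card_leP b); exists r; split=> [p [p1 p2]|p q [p1 p2] [q1 q2] e].
  by have [] := rP _ p1 p2.
case: (pair_lt_total p q) => [//|[pq|qp]].
- by case: ((rP _ q1 q2).2 _ pq).
- by case: ((rP _ p1 p2).2 _ qp).
Qed.

Lemma bigcup_card_seg (V U : choiceType) (D : set V) (F : V -> set U) b :
  infinite_set (seg b) -> D #<= seg b -> (forall i, D i -> F i #<= seg b) ->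
  \bigcup_(i in D) F i #<= seg b.
Proof.
have [[v0 _]|D0] := pselect (D !=set0); last first.
  move=> _ _ _; have -> : \bigcup_(i in D) F i = set0.
    by apply/seteqP; split=> // x [i Di _]; apply: D0; exists i.
  exact: card_ge0.
move=> infb /(inj_card_leP b)[f [fb finj]] Fb.
have /choice[g gP] : forall i, exists g : U -> K, D i ->
    (forall x : U, F i x -> g x < b) /\
    (forall x y : U, F i x -> F i y -> g x = g y -> x = y).
  move=> i; case: (pselect (D i)) => [Di|nDi]; last by exists (fun=> b).
  by have [g ?] := (inj_card_leP b).1 (Fb i Di); exists g.
(* [s x] selects one set containing [x]; the pair of its code and the code of [x] inside it
   determines [x]. *)
have /choice[s sP] : forall x : U, exists i, (\bigcup_(i in D) F i) x -> D i /\ F i x.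
  move=> x; case: (pselect ((\bigcup_(i in D) F i) x)) => [[i Di Fi]|nx].
    by exists i.
  by exists v0.
apply: card_le_trans (seg_square_card infb).
apply/(inj_card_leP (b, b)); exists (fun x : U => (f (s x), g (s x) x)).
split=> [x /sP[Ds Fs]|x y /sP[Dx Fx] /sP[Dy Fy] [e1 e2]].
  by split; [exact: fb|exact: (gP _ Ds).1].
have e := finj _ _ Dx Dy e1; rewrite -e in e2 Fy.
exact: (gP _ Dx).2 e2.
Qed.

Lemma setU_card_seg (U : choiceType) (A B : set U) b :
  infinite_set (seg b) -> A #<= seg b -> B #<= seg b -> A `|` B #<= seg b.
Proof.
move=> infb Ab Bb.
have -> : A `|` B = \bigcup_(i in [set: bool]) (if i then A else B).
  apply/seteqP; split=> [x [?|?]|x [[] _ ?]].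
  - by exists true.
  - by exists false.
  - by left.
  - by right.
apply: bigcup_card_seg => // [|[] //].
by apply: card_le_trans ((infiniteP _).1 infb); exact: countableP.
Qed.

(** * Cofinality *)

(* The records of an injection [A -> o] are still cofinal, and on them the
   injection is increasing, so their order type is at most [o]. *)
Lemma cf_le_card I m A o : has_cf I m -> cofinal_in I A -> is_ordinal o ->
  A #<= o -> m `<=` o.
Proof.
move=> [_ cfmin] [AI Acof] oo Ao.
have [[a0 Aa0]|A0] := pselect (A !=set0); last first.
  suff m0 : m `<=` set0 by move=> x /m0.
  apply: (cfmin A) => //; exists id; split=> //.
  apply/seteqP; split=> x; first by case=> ? [].
  by move=> Ax; case: A0; exists x.
have [f [fo finj]] := (inj_card_leP a0).1 Ao.
pose R := [set x | A x /\ forall y, A y -> f y < f x -> y < x].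
have Rlt x y : R x -> R y -> x < y -> f x < f y.
  move=> [Ax xrec] [Ay _]; case: (ltgtP (f x) (f y)) => // [fyx|e] xy.
    by have := lt_trans xy (xrec _ Ay fyx); rewrite ltxx.
  by rewrite (finj _ _ Ax Ay e) ltxx in xy.
have Rcof : cofinal_in I R.
  split=> [x [/AI]//|b Ib].
  have [|y [x [Ax bx <-]] ymin] := @wo_min (f @` [set x | A x /\ b <= x]).
    by have [x Ax bx] := Acof b Ib; exists (f x), x.
  exists x => //; split=> // z Az fyx; rewrite ltNge; apply/negP => xz.
  have : f x <= f z.
    by apply: ymin; exists z => //; split=> //; exact: le_trans xz.
  by rewrite leNgt fyx.
have [o' [h enh]] := enum_exists R.
apply: subset_trans (cfmin _ _ Rcof (ex_intro _ h enh)) _ => i o'i.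
have enk : enumerates o' ((f \o h) @` o') (f \o h).
  split=> //; first exact: enum_ordinal enh.
  move=> j k oj ok jk.
  by apply: Rlt; rewrite ?(enum_lt enh)//; exact: enum_mem enh _ _.
have := enum_ge enk o'i; rewrite le_eqVlt => /orP[/eqP->|ik].
  by apply: fo; have [] := enum_mem enh o'i.
by apply: (oo _ _ ik); apply: fo; have [] := enum_mem enh o'i.
Qed.

(** A successor ordinal is either finite or equinumerous with its predecessor, so it is no infinite
    cardinal. *)
Lemma cardinal_seg_succ I i : infinite_cardinal I -> I i ->
  ~ I `<=` i |` seg i.
Proof.
move=> [[oI cI] infI] Ii Isub.
have [fini|infi] := pselect (finite_set (seg i)).
  apply: infI; apply: (sub_finite_set Isub).
  by rewrite finite_setU; split => //; exact: finite_set1.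
apply: (cI i Ii); apply: card_le_trans (infinite_setU1_card i infi).
exact: subset_card_le.
Qed.

Lemma cardinal_limit I i : infinite_cardinal I -> I i -> exists2 j, I j & i < j.
Proof.
move=> cI Ii; apply: contrapT => nj; apply: (cardinal_seg_succ cI Ii) => x Ix.
case: (ltgtP x i) => [xi|ix|->]; [by right| |by left].
by case: nj; exists x.
Qed.

Lemma cardinal_succ I i j : infinite_cardinal I -> I i -> is_succ i j -> I j.
Proof.
move=> cI Ii [ij jmin]; have [[oI _] _] := cI.
have [k Ik /jmin] := cardinal_limit cI Ii.
by rewrite le_eqVlt => /orP[/eqP->|/oI]//; apply.
Qed.

(** A point of [A] whose index is outside [xi] would have at least [xi] predecessors in [A]. *)
Lemma otp_le xi A : is_cardinal xi ->
  (forall x, A x -> ~ (xi #<= A `&` seg x)) -> exists2 o, has_otp A o & o `<=` xi.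
Proof.
move=> [oxi _] Ax; have [o [f enf]] := enum_exists A.
exists o; first by exists f.
move=> i oi; apply: contrapT => nxi.
apply: (Ax (f i)); first exact: enum_mem enf _ oi.
have := enum_seg_card enf oi; rewrite card_eq_le => /andP[+ _].
by apply: card_le_trans; apply: subset_card_le; apply: ordinal_subN.
Qed.

(** * Clubs *)

(** Uncountable cofinality, in the form that bounds countable iterations; it covers both segments
    and [K] itself. *)
Definition omega_bounded I := forall x_ : nat -> K,
  (forall n, I (x_ n)) -> exists2 b, I b & forall n, x_ n < b.

Lemma cf_gt_omega_bounded a : E_cf_gt ord_omega a -> omega_bounded (seg a).
Proof.
move=> [m am wm] x_ xa; apply: contrapT => nb.
have [om cfm] := am.
have oomega : is_ordinal (@ord_omega _ K).
  by move=> x y xy; apply: sub_finite_set; apply/seg_sub/ltW.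
(* Being of the form [seg b], a finite [ord_omega] would contain [b] itself. *)
have infomega : infinite_set (@ord_omega _ K).
  have om' : is_ordinal m.
    by have [A [_ [f enf]]] := om; exact: enum_ordinal enf.
  have [b mb wE] := ordinal_proper oomega om' wm.
  rewrite wE => finb; have : (@ord_omega _ K) b by [].
  by rewrite wE /seg/= ltxx.
have xcof : cofinal_in (seg a) (range x_).
  split=> [_ [n _ <-]//|b ba]; apply: contrapT => nx; apply: nb.
  exists b => // n; rewrite ltNge; apply/negP => bx.
  by apply: nx; exists (x_ n) => //; exists n.
have : m `<=` @ord_omega _ K.
  apply: (cf_le_card am xcof oomega).
  by apply: (card_le_trans (card_image_le _ _)); apply/infiniteP.
by case: wm => _ h /h.
Qed.

(** Accumulation points; the first clause excludes the least point of [K], where the second is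
    vacuous. *)
Definition limit_of A x := seg x !=set0 /\
  forall z, z < x -> exists2 y, A y & z < y < x.

Lemma limit_ofP A x :
  limit_of A x <-> seg x !=set0 /\ osup (A `&` seg x) = seg x.
Proof.
split=> -[x0 H]; split=> //.
  apply/seteqP; split=> [z [y [_ yx] zy]|z /H[y Ay /andP[zy yx]]].
    exact: lt_trans yx.
  by exists y.
move=> z zx; have [y [Ay yx] zy] : osup (A `&` seg x) z by rewrite H.
by exists y => //; rewrite zy.
Qed.

Lemma limit_of_sub A B x : A `<=` B -> limit_of A x -> limit_of B x.
Proof. by move=> AB [x0 H]; split=> // z /H[y /AB By zyx]; exists y. Qed.

Lemma clubP I C : is_ordinal I ->
  club_in I C <-> [/\ C `<=` I, forall x, I x -> limit_of C x -> C x &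
                    forall x, I x -> exists2 y, C y & x < y].
Proof.
move=> oI; split=> [[[CI Cl] Cu]|[CI Cl Cu]].
  split=> // [x Ix /limit_ofP[]|x Ix]; first exact: Cl.
  by have [y Cy xy] : osup C x; [rewrite Cu|exists y].
split; first by split=> // x Ix x0 xC; apply: Cl => //; apply/limit_ofP.
apply/seteqP; split=> [x [y /CI Iy xy]|x /Cu[y]]; [exact: oI Iy|by exists y].
Qed.

Lemma nxt_mono A x y : (exists2 z, A z & y < z) -> x <= y ->
  nxt A x <= nxt A y.
Proof.
move=> yA xy; have [Ay yn _] := nxtP yA.
have [|_ _ h] := @nxtP A x; first by exists (nxt A y) => //; apply: le_lt_trans yn.
by apply: h => //; apply: le_lt_trans yn.
Qed.

Lemma closure_point I (h : K -> K) : is_ordinal I -> omega_bounded I ->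
  (forall x, I x -> I (h x)) -> (forall x, I x -> x < h x) ->
  (forall x y, I y -> x <= y -> h x <= h y) ->
  forall x, I x -> exists g, [/\ I g, x < g & forall y, y < g -> h y < g].
Proof.
move=> oI wI hI hlt hmono x Ix.
have Iit n : I (iter n h x) by elim: n => //= n /hI.
have [b0 Ib0 b0P] := wI _ Iit.
have [|g gP gmin] := @wo_min [set b | forall n, iter n h x < b].
  by exists b0.
exists g; split=> [||y yg].
- by have := gmin _ b0P; rewrite le_eqVlt => /orP[/eqP->|/oI]//; apply.
- exact: (gP 0%N).
apply: contrapT => /negP; rewrite -leNgt => ghy.
have : exists n, y <= iter n h x.
  apply: contrapT => ny; have : g <= y.
    apply: gmin => n; rewrite ltNge; apply/negP => yn; apply: ny; by exists n.
  by rewrite leNgt yg.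
move=> [n yn]; have := le_lt_trans (hmono _ _ (Iit n) yn) (gP n.+1).
by rewrite ltNge ghy.
Qed.

Lemma club_setI I C D : is_ordinal I -> omega_bounded I ->
  club_in I C -> club_in I D -> club_in I (C `&` D).
Proof.
move=> oI wI /(clubP _ oI)[CI Cl Cu] /(clubP _ oI)[DI Dl Du].
apply/(clubP _ oI); split=> [x [/CI]//|x Ix xCD|x Ix].
  by split; [apply: Cl|apply: Dl] => //; apply: limit_of_sub xCD => y [].
(* Each application passes a point of [C] and then one of [D], so a closure point of [h] is a limit
   of both. *)
pose h y := nxt D (nxt C y).
have hP y : I y -> [/\ I (h y), C (nxt C y), D (h y) & y < nxt C y < h y].
  move=> Iy; have [Cn yn _] := nxtP (Cu y Iy).
  have [Dn nn _] := nxtP (Du _ (CI _ Cn)).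
  by split=> //; [exact: DI|rewrite yn].
have [||y z Iz yz|g [Ig xg gcl]] := @closure_point I h oI wI _ _ _ x Ix.
- by move=> y /hP[].
- by move=> y /hP[_ _ _ /andP[]]; exact: lt_trans.
- by apply: nxt_mono; [apply: Du; apply: CI; case: (nxtP (Cu z Iz))|exact: nxt_mono (Cu z Iz) yz].
exists g => //; have g0 : seg g !=set0 by exists x.
split; [apply: Cl|apply: Dl] => //; split=> // z zg;
  have [_ Cn Dn /andP[zn nh]] := hP _ (oI _ _ zg Ig).
  by exists (nxt C z) => //; rewrite zn (lt_trans nh (gcl _ zg)).
by exists (h z) => //; rewrite (lt_trans zn nh) gcl.
Qed.

Lemma club_above I C x : is_ordinal I -> I x -> club_in I C ->
  club_in I (C `&` [set y | x < y]).
Proof.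
move=> oI Ix /(clubP _ oI)[CI Cl Cu].
apply/(clubP _ oI); split=> [y [/CI]//|y Iy [y0 yl]|y Iy].
  split; first by apply: Cl => //; split=> // z /yl[t [Ct _]]; exists t.
  by case: y0 => z /yl[t [_ /= xt] /andP[_]]; apply: lt_trans.
have [|z Cz yz] := Cu (Order.max x y); first by case: (leP x y).
by exists z; [split=> //=|]; apply: le_lt_trans yz; rewrite le_max lexx ?orbT.
Qed.

Definition closure_in I X := [set y | I y /\ (X y \/ limit_of X y)].

Lemma limit_of_closure I X x : limit_of (closure_in I X) x -> limit_of X x.
Proof.
move=> [x0 H]; split=> // z /H[y [_ [Xy|[_ yl]]] /andP[zy yx]].
  by exists y => //; rewrite zy.
have [t Xt /andP[zt ty]] := yl z zy.
by exists t => //; rewrite zt (lt_trans ty yx).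
Qed.

Lemma closure_club I X : is_ordinal I -> X `<=` I ->
  (forall x, I x -> exists2 y, X y & x < y) -> club_in I (closure_in I X).
Proof.
move=> oI XI Xu; apply/(clubP _ oI); split=> [x []//|x Ix /limit_of_closure xl|x].
  by split=> //; right.
by move=> /Xu[y Xy xy]; exists y => //; split; [exact: XI|left].
Qed.

(* Sending a point of the closure to the next point of [A] is injective, so the
   closure is not larger than [A]. *)
Lemma small_club g m : infinite_cardinal m -> has_cf (seg g) m ->
  exists e, [/\ club_in (seg g) e, e #<= m &
                forall z, z < g -> ~ (m #<= e `&` seg z)].
Proof.
move=> im [[A [[Ag Acof] [f enf]]] _].
have Au x : x < g -> exists2 y, A y & x < y.
  move=> xg; have [y Ay xy] := Acof x xg.
  have [i mi fi] := enum_surj enf Ay; have [j mj ij] := cardinal_limit im mi.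
  exists (f j); first exact: enum_mem enf _ mj.
  by apply: le_lt_trans xy _; rewrite -fi (enum_lt enf).
have og := @seg_ordinal g.
exists (closure_in (seg g) A).
have nxt_lt x y : closure_in (seg g) A y -> x < y -> x < g -> nxt A x < nxt A y.
  move=> [yg yA] xy xg; have [_ xn xmin] := nxtP (Au x xg).
  have [Ay yn _] := nxtP (Au y yg); apply: le_lt_trans yn.
  case: yA => [Ay'|[_ /(_ _ xy)[t At /andP[xt ty]]]]; first exact: xmin.
  exact: le_trans (xmin _ At xt) (ltW ty).
have nxt_inj x y : closure_in (seg g) A x -> closure_in (seg g) A y ->
    nxt A x = nxt A y -> x = y.
  move=> ex ey e; case: (ltgtP x y) => // [xy|yx].
    by have := nxt_lt _ _ ey xy ex.1; rewrite e ltxx.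
  by have := nxt_lt _ _ ex yx ey.1; rewrite e ltxx.
split; first exact: closure_club.
  apply: (@card_le_trans _ _ _ A).
    apply/(inj_card_leP g); exists (nxt A); split=> // x [xg _].
    by case: (nxtP (Au x xg)).
  by have := enum_card enf; rewrite card_eq_le => /andP[].
move=> z zg me.
(* The second successor [f i] strictly bounds [nxt A x] for all [x < z], so these images lie in a
   proper initial part of [A], of size below [m]. *)
have [Az zn _] := nxtP (Au z zg); have [Az' zn' _] := nxtP (Au _ (Ag _ Az)).
have [i mi fi] := enum_surj enf Az'.
apply: (im.1.2 i mi); apply: (card_le_trans me).
apply: (@card_le_trans _ _ _ (A `&` seg (f i))).
  apply/(inj_card_leP g); exists (nxt A); split=> [x [[xg _] xz]|x y [ex _] [ey _]].
    have [Ax _ _] := nxtP (Au x xg); split=> //; rewrite fi.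
    by apply: le_lt_trans zn'; apply: nxt_mono (Au z zg) (ltW xz).
  exact: nxt_inj.
by have := enum_seg_card enf mi; rewrite card_eq_le => /andP[].
Qed.

Lemma small_clubs m : infinite_cardinal m -> exists e : K -> set K,
  [/\ forall g x, x < g -> limit_of (e g) x -> e g x,
      forall g, e g #<= m,
      forall g, E_cf m g -> club_in (seg g) (e g)
    & forall g z, z < g -> ~ (m #<= e g `&` seg z)].
Proof.
move=> im; have m0 : ~ (m #<= @set0 K).
  by move=> /card_le0P m0; apply: im.2; rewrite m0; exact: finite_set0.
have /choice[e eP] : forall g, exists e,
    [/\ forall x, x < g -> limit_of e x -> e x, e #<= m,
        E_cf m g -> club_in (seg g) e &
        forall z, z < g -> ~ (m #<= e `&` seg z)].
  move=> g; have [Eg|nEg] := pselect (E_cf m g).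
    have [e [eclub em esmall]] := small_club im Eg; exists e; split=> //.
    by have /(clubP _ (@seg_ordinal g))[] := eclub.
  (* Off [E_cf m] the empty set serves, so that closedness and smallness hold at every [g]. *)
  exists set0; split=> [x xg [[y yx] /(_ y yx)[]//]| |//|z _].
    exact: card_ge0.
  by rewrite set0I.
by exists e; split=> [g|g|g|g]; have [] := eP g.
Qed.

Lemma unbounded_otp m g A b : E_cf m g -> A `<=` seg g ->
  (forall x, x < g -> exists2 y, A y & x < y) -> b < g ->
  exists2 o, has_otp (A `&` [set x | b < x]) o & m `<=` o.
Proof.
move=> [_ mmin] Ag Au bg.
have [o [f enf]] := enum_exists (A `&` [set x | b < x]).
exists o; first by exists f.
apply: (mmin (A `&` [set x | b < x])); last by exists f.
split=> [x [/Ag]//|x xg].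
have [|y Ay xy] := Au (Order.max b x); first by case: (leP b x).
move: xy; rewrite gt_max => /andP[by_ xy].
by exists y; [split|exact: ltW].
Qed.

(** * Bounded sets and clubs in a regular uncountable cardinal *)

Section Regular.
Context (hK : regular_uncountable_cardinal K).

(** By regularity an unbounded set has order type [K], hence size [K]. *)
Lemma regular_bounded A : ~ ([set: K] #<= A) -> exists b, forall x, A x -> x < b.
Proof.
move=> nA; apply: contrapT => nb; apply: nA.
have [o [f enf]] := enum_exists A.
case: hK => _ _ [_ cfK] _.
have /cfK/(_ (ex_intro _ f enf)) oT : cofinal_in [set: K] A.
  split=> // b _; apply: contrapT => nx; apply: nb; exists b => x Ax.
  by rewrite ltNge; apply/negP => bx; apply: nx; exists x.
apply: (@card_le_trans _ _ _ o); first exact: subset_card_le.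
by have := enum_card enf; rewrite card_eq_le => /andP[].
Qed.

Lemma regular_bounded_seg a (f : K -> K) :
  exists b, forall x, x < a -> f x < b.
Proof.
have [|b bP] := @regular_bounded (f @` seg a).
  move=> KA; case: hK => _ [_ /(_ a I)] + _ _; apply.
  exact: card_le_trans KA (card_image_le _ _).
by exists b => x xa; apply: bP; exists x.
Qed.

Lemma regular_omega_bounded : omega_bounded [set: K].
Proof.
move=> x_ _; have [|b bP] := @regular_bounded (range x_).
  move=> KA; case: hK => _ _ _; apply.
  exact: card_le_trans KA (card_image_le _ _).
by exists b => // n; apply: bP; exists n.
Qed.

Lemma regular_nomax x : exists y, x < y.
Proof.
have [b _ bP] := regular_omega_bounded (fun=> I : [set: K] x).
by exists b; exact: bP 0%N.
Qed.

Lemma setT_ordinal : is_ordinal [set: K]. Proof. by []. Qed.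

Lemma regular_closure_point (h : K -> K) : (forall x, x < h x) ->
  (forall x y, x <= y -> h x <= h y) ->
  forall x, exists2 g, x < g & forall y, y < g -> h y < g.
Proof.
move=> hlt hmono x.
have [//|//|y z _|g [_ xg gcl]] :=
  closure_point setT_ordinal regular_omega_bounded _ _ _ (I : [set: K] x) (h := h).
  exact: hmono.
by exists g.
Qed.

Lemma club_limits D : club_in [set: K] D -> club_in [set: K] (limit_of D).
Proof.
move=> /(clubP _ setT_ordinal)[_ Dl Du]; apply/(clubP _ setT_ordinal).
split=> // [x _ xl|x _].
  by apply: (@limit_of_closure setT); apply: limit_of_sub xl => y yl; split=> //; right.
have [||g xg gcl] := @regular_closure_point (nxt D) _ _ x.
- by move=> y; case: (nxtP (Du y I)).
- by move=> y z; apply: nxt_mono; exact: Du.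
exists g => //; split; first by exists x.
move=> z zg; have [Dn zn _] := nxtP (Du z I).
by exists (nxt D z) => //; rewrite zn gcl.
Qed.

Lemma club_bigcap a (D : K -> set K) :
  (forall i, i < a -> club_in [set: K] (D i)) ->
  club_in [set: K] (\bigcap_(i in seg a) D i).
Proof.
move=> Dclub; apply/(clubP _ setT_ordinal); split=> // [x _ xl i ia|x _].
  have /(clubP _ setT_ordinal)[_ Dl _] := Dclub i ia.
  by apply: Dl => //; apply: limit_of_sub xl => y; apply.
have Du i y : i < a -> exists2 z, D i z & y < z.
  by move=> ia; have /(clubP _ setT_ordinal)[_ _] := Dclub i ia; apply.
pose B y := [set b | y < b /\ forall i, i < a -> nxt (D i) y < b].
have B0 y : B y !=set0.
  have [b bP] := regular_bounded_seg a (fun i => nxt (D i) y).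
  have [c yc] := regular_nomax y.
  exists (Order.max b c); split; first by rewrite lt_max yc orbT.
  by move=> i ia; rewrite lt_max bP.
(* A point above [y] and above the next points of all [D i] at once; regularity of [K] provides
   one. *)
pose h y := wmin y (B y).
have [||g xg gcl] := @regular_closure_point h _ _ x.
- by move=> y; case: (wminP y (B0 y)) => -[].
- move=> y z yz; case: (wminP y (B0 y)) => _; apply.
  case: (wminP z (B0 z)) => -[zh Bh] _; split; first exact: le_lt_trans zh.
  by move=> i ia; apply: le_lt_trans (Bh i ia); apply: nxt_mono yz; exact: Du.
exists g => // i ia; have /(clubP _ setT_ordinal)[_ Dl _] := Dclub i ia.
apply: Dl => //; split=> [|z zg]; first by exists x.
have [Dn zn _] := nxtP (Du i z ia); exists (nxt (D i) z) => //; rewrite zn.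
by case: (wminP z (B0 z)) => -[_ /(_ i ia) /lt_trans + _]; apply; exact: gcl.
Qed.

(** * Filling in a C-sequence *)

(** With length one, the section consists of the second point of [A]; this is how a guess of the
    hypothesis is read off. *)
Lemma suc_section_one A x y : A x -> (forall z, A z -> x <= z) -> A y ->
  x < y -> (forall z, A z -> x < z -> y <= z) -> suc_section ord_one A y.
Proof.
move=> Ax xmin Ay xy ymin; have [o [f enf]] := enum_exists A.
have [i oi fi] := enum_surj enf Ax; have [j oj fj] := enum_surj enf Ay.
have oo := enum_ordinal enf.
exists o, f, i, j; split=> //.
  move=> k; rewrite leNgt; apply/negP => ki; have ok := oo _ _ ki oi.
  by have := xmin _ (enum_mem enf ok); rewrite -fi leNgt (enum_lt enf)// ki.
split=> [|k ik]; first by rewrite -(enum_lt enf)// fi fj.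
rewrite leNgt; apply/negP => kj; have ok := oo _ _ kj oj.
have := ymin _ (enum_mem enf ok).
by rewrite -fi -fj (enum_lt enf)// => /(_ ik); rewrite leNgt (enum_lt enf)// kj.
Qed.

(** A successor index below [m] leaves fewer than [m] points before [y], so [m] points below [z]
    force [y < z]. The witness [w] is the preceding point in the enumeration. *)
Lemma suc_sectionP m A y z : infinite_cardinal m -> suc_section m A y ->
  m #<= A `&` seg z ->
  [/\ A y, y < z & exists w, [/\ A w, w < y & forall t, A t -> t < y -> t <= w]].
Proof.
move=> im [o [f [i [j [enf mi ij oj ->]]]]] mA.
have oi : o i by case: ij => + _ => /(enum_ordinal enf); apply.
split; first exact: enum_mem enf _ oj.
  rewrite ltNge; apply/negP => zf.
  apply: (im.1.2 j (cardinal_succ im mi ij)); apply: (card_le_trans mA).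
  apply: (@card_le_trans _ _ _ (A `&` seg (f j))).
    by apply: subset_card_le => x [Ax xz]; split=> //; apply: lt_le_trans zf.
  by have := enum_seg_card enf oj; rewrite card_eq_le => /andP[].
exists (f i); split; [exact: enum_mem enf _ oi|by rewrite (enum_lt enf)//; case: ij|].
move=> t /(enum_surj enf)[k ok <-]; rewrite (enum_lt enf)// => kj.
rewrite leNgt (enum_lt enf)//; apply/negP => ik.
by case: ij => _ /(_ k ik); rewrite leNgt kj.
Qed.

(* Filling only below points of one parity leaves the gap below the least point
   of [A] above a given start empty, whenever the following gap is filled. *)
Lemma parity A : exists P : K -> bool,
  forall x, A x -> (exists2 y, A y & x < y) -> P (nxt A x) = ~~ P x.
Proof.
(* [P x] holds when [x] directly follows a point of [A] where [P] fails; points without a direct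
   predecessor get [false]. *)
have [|P PE] := @wf_recursion _ _ _ wfK false (fun x P =>
    `[< exists y, [/\ A y, y < x, nxt A y = x & P y = false] >]).
  move=> x P Q PQ; apply: asbool_equiv_eq.
  by split=> -[y [Ay yx xE Py]]; exists y; split=> //; rewrite -Py PQ.
exists P => x Ax xA; have [An xn nmin] := nxtP xA.
rewrite PE; apply/idP/idP => [/asboolP|/negbTE Px]; last first.
  by apply/asboolP; exists x.
move=> [y [Ay yn yE Py]]; apply/negP => Px; have := Px; suff -> : x = y by rewrite Py.
case: (ltgtP x y) => // [xy|yx].
  by have := nmin _ Ay xy; rewrite leNgt yn.
have [|_ _ /(_ _ Ax yx)] := @nxtP A y; first by exists x.
by rewrite yE leNgt xn.
Qed.

(* [nxt C x] is the right end of the gap of [C] that contains [x]; [M] marks the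
   gaps to be filled. *)
Definition fill C (e : K -> set K) Q M a :=
  C `|` [set x | [/\ x < a, Q x, M (nxt C x) & e (nxt C x) x]].

Definition fill_club C e Q M a := closure_in (seg a) (fill C e Q M a).

Section Fill.
Context {a : K} {C : set K} {e : K -> set K} {Q M : set K}.
Context (Cclub : club_in (seg a) C).
Context (eclosed : forall g x, x < g -> limit_of (e g) x -> e g x).
Let F := fill_club C e Q M a.

Lemma fill_sub : fill C e Q M a `<=` seg a.
Proof. by case: Cclub => -[Ca _] _ x [/Ca//|[]]. Qed.

Lemma fill_next x : x < a -> [/\ C (nxt C x), x < nxt C x &
  forall y, C y -> x < y -> nxt C x <= y].
Proof.
move=> xa; apply: nxtP.
by have /(clubP _ (@seg_ordinal a))[_ _] := Cclub; apply.
Qed.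

Lemma fill_clubP : club_in (seg a) F.
Proof.
apply: closure_club; [exact: seg_ordinal|exact: fill_sub|].
by move=> x /fill_next[Cn xn _]; exists (nxt C x) => //; left.
Qed.

Lemma fill_sub_club : fill C e Q M a `<=` F.
Proof. by move=> x Fx; split; [exact: fill_sub|left]. Qed.

(** Closing off adds nothing outside the inserted pieces: as [C] is closed, the points accumulating
    at [y] eventually lie in the gap of [y], hence in one closed set [e (nxt C y)]. *)
Lemma fill_club_new y : F y -> ~ C y -> M (nxt C y) /\ e (nxt C y) y.
Proof.
move=> [ya Fy] nCy; case: Fy => [[//|[]//]|[y0 yl]].
have [Cn yn nmin] := fill_next ya.
have /(clubP _ (@seg_ordinal a))[Ca Cl _] := Cclub.
have [z zy zC] : exists2 z, z < y & forall t, C t -> z < t -> y <= t.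
  apply: contrapT => nz; apply: nCy; apply: Cl => //; split=> // z zy.
  apply: contrapT => nt; apply: nz; exists z => // t Ct zt.
  by rewrite leNgt; apply/negP => ty; apply: nt; exists t => //; rewrite zt.
have H t : z < t -> t < y -> fill C e Q M a t -> M (nxt C y) /\ e (nxt C y) t.
  move=> zt ty [Ct|[ta _ Mt et]]; first by have := zC t Ct zt; rewrite leNgt ty.
  have [Ct tn tmin] := fill_next ta.
  suff -> : nxt C y = nxt C t by [].
  apply/le_anti/andP; split; last by apply: tmin => //; apply: lt_trans yn.
  apply: nmin => //; have := zC _ Ct (lt_trans zt tn).
  by rewrite le_eqVlt => /orP[/eqP yE|//]; case: nCy; rewrite yE.
split.
  by have [t Ft /andP[zt ty]] := yl z zy; case: (H t zt ty Ft).
apply: eclosed => //; split=> // u uy.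
have [|t Ft /andP[zt ty]] := yl (Order.max z u); first by case: (leP z u).
move: zt; rewrite gt_max => /andP[zt ut].
by exists t; [case: (H t zt ty Ft)|rewrite ut].
Qed.

(** Below any [x], the filled set is covered by fewer than [xi] points of [C] and the sets [e y] at
    these points, all of size at most [seg b]. *)
Lemma fill_club_otp xi b : infinite_cardinal xi -> xi b ->
  infinite_set (seg b) -> (forall g, e g #<= seg b) ->
  (exists2 o, has_otp C o & o `<=` xi) -> exists2 o, has_otp F o & o `<=` xi.
Proof.
move=> [cxi infxi] xib infb eb [o [f enf] oxi]; apply: otp_le => // x [xa _] xF.
have [Cn xn nmin] := fill_next xa.
have /(clubP _ (@seg_ordinal a))[Ca _ _] := Cclub.
have [Cn' nn _] := fill_next (Ca _ Cn).
have [i oi fi] := enum_surj enf Cn'.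
(* One infinite ordinal below [xi] that bounds both the number of gaps (at most [i]) and the size of
   each piece (at most [b]). *)
pose c := Order.max b i; have xic : xi c by rewrite /c; case: (leP b i) => // _; exact: oxi.
have bc : seg b `<=` seg c by apply: seg_sub; rewrite /c le_max lexx.
have infc : infinite_set (seg c) by move=> /(sub_finite_set bc).
have Cc : C `&` seg (f i) #<= seg c.
  apply: (@card_le_trans _ _ _ (seg i)).
    by have := enum_seg_card enf oi; rewrite card_eq_le => /andP[].
  by apply/subset_card_le/seg_sub; rewrite /c le_max lexx orbT.
apply: (cxi.2 c xic); apply: (card_le_trans xF).
apply: (@card_le_trans _ _ _
  ((C `&` seg (f i)) `|` \bigcup_(y in C `&` seg (f i)) e y)).
  apply: subset_card_le => y [Fy yx].
  have [Cy|nCy] := pselect (C y).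
    by left; split=> //; rewrite fi /seg/= (lt_trans yx)// (lt_trans xn).
  have [_ ey] := fill_club_new Fy nCy; right; exists (nxt C y) => //.
  have [Cny _ ymin] := fill_next (lt_trans yx xa); split=> //.
  rewrite fi; apply: le_lt_trans nn; apply: ymin => //; exact: lt_trans xn.
apply: setU_card_seg => //; apply: bigcup_card_seg => // y _.
by apply: (card_le_trans (eb y)); exact: subset_card_le.
Qed.

End Fill.

(** * From guessing one reflection point to guessing [sigma] points of [T] *)

Section Transfer.
Context {sigma nu xi S T G : set K} {J : K -> set (set K)} {e : K -> set K}.
Context (isigma : infinite_cardinal sigma) (inu : infinite_cardinal nu).
Context (ixi : infinite_cardinal xi) (nu_xi : nu `<` xi).
Context (eclosed : forall g x, x < g -> limit_of (e g) x -> e g x).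
Context (ecard : forall g, e g #<= nu).
Context (eclub : forall g, G g -> club_in (seg g) (e g)).
(** The cut [z] balances two demands: below it, [A] has [sigma] points past [b], so the whole
    section fits there, while [e g] has fewer than [nu] points, so [nu] distinct counterexamples do
    not. *)
Context (esplit : forall g A b, G g -> A `<=` e g ->
  (forall x, x < g -> exists2 y, A y & x < y) -> b < g ->
  exists z, [/\ z <= g, sigma #<= A `&` [set x | b < x] `&` seg z &
                ~ (nu #<= e g `&` seg z)]).

(** Both [D] and [e g] are club in [g]; as [g] has uncountable cofinality, the stationary set [T]
    meets every tail of their intersection. *)
Lemma limit_guess_cofinal D g : club_in [set: K] D -> limit_of D g -> G g ->
  Tr T g -> forall x, x < g -> exists2 y, (D `&` T `&` e g) y & x < y.
Proof.
move=> /(clubP _ setT_ordinal)[_ Dl _] Dg Gg [/cf_gt_omega_bounded wg [_ Tg]] x xg.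
have og := @seg_ordinal g.
have Dclub : club_in (seg g) (D `&` seg g).
  apply/(clubP _ og); split=> [y []//|y yg yl|y yg].
    by split=> //; apply: Dl => //; apply: limit_of_sub yl => z [].
  by have [z Dz /andP[yz zg]] := Dg.2 y yg; exists z.
have := club_above og xg (club_setI og wg (eclub Gg) Dclub).
by move=> /Tg[y [[Ty _] [[ey [Dy _]] xy]]]; exists y.
Qed.

(** Let [c] be the first point of [C] from [b] on and [g] the next one. The gap below [g] is filled
    and the one below [c] is not, so the section consists of points strictly between [c] and [g]. *)
Lemma fill_guess a C n b (P : K -> bool) (D W : K -> set K) (E : set K) :
  club_in (seg a) C ->
  (forall x, C x -> (exists2 y, C y & x < y) -> P (nxt C x) = ~~ P x) ->
  b < a -> club_in [set: K] E -> nu = seg n ->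
  (forall i, i < n -> E `<=` D i) ->
  (forall i j, i < j -> j < n -> D j `<=` W i) ->
  suc_section ord_one (C `\` seg b) `<=` limit_of E `&` (G `&` Tr T) ->
  exists i p, i < n /\ suc_section sigma
    (fill_club C e (D i `&` T) [set y | P y = p] a `\` seg b) `<=` W i `&` T.
Proof.
move=> Cclub Ppar ba Eclub nuE ED DW guess.
have oa := @seg_ordinal a.
have /(clubP _ oa)[Ca _ Cu] := Cclub.
have [c [Cc /negP nbc] cmin] : exists2 c, (C `\` seg b) c &
    forall y, (C `\` seg b) y -> c <= y.
  apply: wo_min; have [c Cc bc] := Cu b ba; exists c; split=> //.
  by rewrite /seg/= => /(lt_trans bc); rewrite ltxx.
have bc : b <= c by rewrite leNgt.
have [Cg cg gmin] := fill_next Cclub (Ca _ Cc); set g := nxt C c in Cg cg gmin.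
have nb x : c < x -> ~ seg b x by move=> cx /(lt_trans cx); rewrite ltNge bc.
have {guess}[Eg [Gg Tg]] : (limit_of E `&` (G `&` Tr T)) g.
  apply: guess; apply: (@suc_section_one _ c) => //.
  - by split=> //; apply/negP.
  - by split=> //; exact: nb.
  - by move=> z [Cz _]; exact: gmin.
have Eu := limit_guess_cofinal Eclub Eg Gg Tg.
have [z [zg sz nuz]] := esplit Gg (@subIsetr _ (E `&` T) (e g)) Eu cg.
(* Otherwise a counterexample for each [i < n] injects [nu] into a set of
   smaller size, because [D j `<=` W i] for [i < j]. *)
have [i iN iW] : exists2 i, i < n &
    forall x, D i x -> T x -> e g x -> x < z -> W i x.
  apply: contrapT => ni; apply: nuz; rewrite nuE.
  have /choice[h hP] : forall i, exists x, i < n ->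
      [/\ D i x, (e g `&` seg z) x & ~ W i x].
    move=> i; case: (pselect (i < n)) => [iN|nin]; last by exists i.
    apply: contrapT => nx; apply: ni; exists i => // x Dx Tx ex xz.
    by apply: contrapT => nW; apply: nx; exists x.
  apply/(inj_card_leP g); exists h; split=> [j /hP[]//|j k jn kn hjk].
  have [Dj _ Wj] := hP j jn; have [Dk _ Wk] := hP k kn.
  case: (ltgtP j k) => // [jk|kj].
  - by case: Wj; rewrite hjk; exact: DW kn _ Dk.
  - by case: Wk; rewrite -hjk; exact: DW jn _ Dj.
(* Filling the gaps with the parity of [g] selects the gap ending at [g]. *)
exists i, (P g); split=> // y.
set M := [set y | P y = P g]; set F := fill_club _ _ _ _ _ => yF.
have Fa x : F x -> x < a by case.
have fillF := @fill_sub_club _ _ e (D i `&` T) M Cclub.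
have between x : c < x -> x < g -> nxt C x = g.
  move=> cx xg; have [Cn xn nmin] := fill_next Cclub (lt_trans xg (Ca _ Cg)).
  apply/le_anti/andP; split; first exact: nmin.
  by apply: gmin => //; exact: lt_trans xn.
have szF : sigma #<= (F `\` seg b) `&` seg z.
  apply: (card_le_trans sz); apply: subset_card_le => x [[[[Ex Tx] ex] cx] xz].
  have xg : x < g by apply: lt_le_trans zg.
  split=> //; split; last exact: nb.
  apply: fillF; right; split; [exact: lt_trans (Ca _ Cg)| | |].
  - by split=> //; exact: ED Ex.
  - by rewrite /M/= between.
  - by rewrite between.
have [[Fy nby] yz [w [[Fw nbw] wy wmax]]] := suc_sectionP isigma yF szF.
have yg := lt_le_trans yz zg.
(* Such a point would be new and lie in the gap ending at [c], whose parity is opposite to that of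
   [g]. *)
have below x : F x -> ~ seg b x -> ~ x < c.
  move=> Fx nbx xc.
  have nCx : ~ C x by move=> Cx; have := cmin x (conj Cx nbx); rewrite leNgt xc.
  have [Mn _] := fill_club_new Cclub eclosed Fx nCx.
  have [Cn xn nmin] := fill_next Cclub (Fa _ Fx).
  have nE : nxt C x = c.
    apply/le_anti/andP; split; first exact: nmin.
    apply: cmin; split=> // nbn; apply: nbx; exact: lt_trans xn nbn.
  move: Mn; rewrite nE /M/= /g Ppar//; last by exists g.
  by case: (P c).
have cw : c <= w by rewrite leNgt; apply/negP; exact: below.
have cy : c < y by apply: le_lt_trans wy.
have nCy : ~ C y by move=> Cy; have := gmin _ Cy cy; rewrite leNgt yg.
have [_ ey] := fill_club_new Cclub eclosed Fy nCy.
rewrite (between _ cy yg) in ey.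
(* A limit of the filled set has no immediate predecessor, but [y] has [w]; so [y] was inserted
   directly and lies in [D i] and [T]. *)
case: Fy => ya [[//|[_ [Dy Ty] _ _]]|[_ /(_ _ wy)[t tF /andP[wt ty]]]].
  by split=> //; exact: iW.
have := wmax t (conj (fillF _ tF) (nb _ (le_lt_trans cw wt))) ty.
by rewrite leNgt wt.
Qed.

Lemma CG_transfer : S `<=` E_cf_gt nu ->
  (forall a, S a -> proper_ideal a (J a)) ->
  (forall a, S a -> exists2 m, has_cf (seg a) m & additive m (J a)) ->
  CG xi S (G `&` Tr T) ord_one J -> CG xi S T sigma J.
Proof.
move=> Scf Jideal Jadd [C [Cclub Cotp Cguess]]; apply: contrapT => noCG.
have [n xin nuE] := ordinal_proper inu.1.1 ixi.1.1 nu_xi.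
have /choice[P Ppar] := fun a => parity (C a).
pose F D p a := fill_club (C a) e (D `&` T) [set y | P a y = p] a.
have setTclub : club_in [set: K] [set: K].
  apply/(clubP _ setT_ordinal); split=> // x _.
  by have [y xy] := regular_nomax x; exists y.
have /choice[W WP] : forall D : set K, exists W, club_in [set: K] W /\
    forall p a, S a ->
      J a [set b | b < a /\ suc_section sigma (F D p a `\` seg b) `<=` W `&` T].
  move=> D.
  (* Each parity has its own club of failure; their intersection defeats both fillings. *)
  have bad p : exists W, club_in [set: K] W /\ forall a, S a ->
      J a [set b | b < a /\ suc_section sigma (F D p a `\` seg b) `<=` W `&` T].
    apply: contrapT => nW; apply: noCG; exists (F D p); split.
    - by move=> a Sa; apply: fill_clubP; exact: Cclub.
    - move=> a Sa; apply: (fill_club_otp (Cclub a Sa) eclosed ixi xin).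
      + by rewrite -nuE; exact: inu.2.
      + by move=> g; rewrite -nuE.
      + exact: Cotp.
    - move=> W Wclub; apply: contrapT => nS; apply: nW; exists W; split=> // a Sa.
      apply: contrapT => nJ; apply: nS; exists a => //; split=> //.
      by move=> b [].
  have [W1 [W1club W1P]] := bad true; have [W2 [W2club W2P]] := bad false.
  exists (W1 `&` W2); split.
    exact: (club_setI setT_ordinal regular_omega_bounded).
  move=> p a Sa; have [_ _ Jsub _ _] := Jideal a Sa.
  case: p; [apply: (Jsub _ _ (W1P a Sa))|apply: (Jsub _ _ (W2P a Sa))];
    by move=> b [ba sub]; split=> // x /sub[[]].
have [|D DE] := @wf_recursion _ _ _ wfK set0
    (fun i D => \bigcap_(j in seg i) W (D j)).
  by move=> i g h gh; apply: eq_bigcapr => j ji; rewrite gh.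
have Dclub i : club_in [set: K] (D i).
  by rewrite DE; apply: club_bigcap => j _; case: (WP (D j)).
have DW i j : i < j -> D j `<=` W (D i) by move=> ij x; rewrite DE; apply.
have DD i j : i <= j -> D j `<=` D i.
  by move=> ij x; rewrite !DE => H k ki; apply: H; apply: lt_le_trans ij.
have [a Sa [_ nJ]] := Cguess _ (club_limits (Dclub n)).
apply: nJ; have [_ J0 Jsub JU _] := Jideal a Sa.
have [m acf addm] := Jadd a Sa.
pose N i := \bigcup_(p in [set: bool])
  [set b | b < a /\ suc_section sigma (F (D i) p a `\` seg b) `<=` W (D i) `&` T].
have NJ i : J a (N i).
  apply: (Jsub _ _ (JU _ _ ((WP (D i)).2 true a Sa) ((WP (D i)).2 false a Sa))).
  by move=> b [[] _ H]; [left|right].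
(* By [fill_guess] the set of good starting points is covered by the sets [N i], [i < n], each in
   the ideal. *)
apply: (Jsub _ (\bigcup_(A in N @` seg n) A)); last first.
  move=> b [ba guess].
  have [|i [p [iN H]]] := fill_guess (Cclub a Sa) (Ppar a) ba (Dclub n) nuE
    _ (fun i j ij _ => DW i j ij) guess.
    by move=> i iN; apply/DD/ltW.
  by exists (N i); [exists i|exists p].
have [m' acf' nu_m'] := Scf a Sa.
have mE : m = m'.
  have [[A [Acof Aotp]] mmin] := acf; have [[A' [Acof' Aotp']] mmin'] := acf'.
  by apply/seteqP; split; [exact: mmin Acof' Aotp'|exact: mmin' Acof Aotp].
have Nn : N @` seg n #<= nu by rewrite nuE; exact: card_image_le.
apply: addm.
- by move=> _ [i _ <-].
- by apply: (card_le_trans Nn); apply: subset_card_le; rewrite mE; case: nu_m'.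
(* A family of size [m] indexed by [nu] would bound the cofinality of [a] by [nu]. *)
- move=> mN; have [[A [Acof [f enf]]] _] := acf.
  case: nu_m' => _; apply; rewrite -mE.
  apply: (cf_le_card acf Acof inu.1.1).
  apply: card_le_trans (card_le_trans mN Nn).
  by have := enum_card enf; rewrite card_eq_le => /andP[].
Qed.

End Transfer.

End Regular.
End WellOrder.

(** * The two cofinalities of the guessed points *)

Unset Implicit Arguments.

Theorem theorem5p5 (d : Order.disp_t) (K : orderType d)
  (sigma nu xi S T : set K) (J : K -> set (set K))
  (hK : regular_uncountable_cardinal K)
  (hsigma : infinite_cardinal sigma)
  (hnu : infinite_cardinal nu)
  (hxi : infinite_cardinal xi)
  (hsigma_nu : sigma `<` nu)
  (hnu_xi : nu `<` xi)
  (hS_cf : S `<=` E_cf_gt nu)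
  (hS : stationary_in [set: K] S)
  (hT : stationary_in [set: K] T)
  (hJ : forall a, S a -> proper_ideal a (J a))
  (hJ_bd : forall a, S a -> bounded_ideal a `<=` J a)
  (hJ_add : forall a, S a ->
     exists2 m, has_cf (seg a) m & additive m (J a)) :
  (CG xi S (E_cf sigma `&` Tr T) ord_one J -> CG xi S T sigma J) /\
  (CG xi S (E_cf nu `&` Tr T) ord_one J -> CG xi S T sigma J).
Proof.
have wfK : well_founded (fun x y : K => x < y) by case: hK.
have [s nus sE] := ordinal_proper wfK hsigma.1.1 hnu.1.1 hsigma_nu.
split.
(* In cofinality [sigma] all of [e g] has size at most [sigma], below [nu], so the cut can be [g]
   itself. *)
- have [e [eclosed ecard eclub _]] := small_clubs wfK hsigma.
  have ecard_nu g : e g #<= nu.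
    by apply: (card_le_trans (ecard g)); apply: subset_card_le; case: hsigma_nu.
  apply: (CG_transfer wfK hK hsigma hnu hxi hnu_xi eclosed ecard_nu eclub) => //.
  move=> g A b Gg Ae Au bg; exists g; split=> //; last first.
    move=> nue; apply: (hnu.1.2 s nus); apply: (card_le_trans nue).
    rewrite -sE; apply: card_le_trans (ecard g).
    by apply: subset_card_le => x [].
  have [o [f enf] so] := unbounded_otp wfK Gg (subset_trans Ae (eclub g Gg).1.1) Au bg.
  apply: (@card_le_trans _ _ _ o); first exact: subset_card_le.
  rewrite setIidl; last by move=> x [/Ae /(eclub g Gg).1.1].
  by have := enum_card enf; rewrite card_eq_le => /andP[].
(* In cofinality [nu] the cut is the point of index [sigma] in the tail of [A]; it lies below [g],
   where [e g] has fewer than [nu] points. *)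
- have [e [eclosed ecard eclub esmall]] := small_clubs wfK hnu.
  apply: (CG_transfer wfK hK hsigma hnu hxi hnu_xi eclosed ecard eclub) => //.
  move=> g A b Gg Ae Au bg.
  have Ag := subset_trans Ae (eclub g Gg).1.1.
  have [o [f enf] nuo] := unbounded_otp wfK Gg Ag Au bg.
  have os := nuo s nus; have [As bs] := enum_mem enf os.
  exists (f s); split; [exact/ltW/Ag| |exact: esmall (Ag _ As)].
  have := enum_seg_card enf os; rewrite card_eq_le => /andP[+ _].
  by rewrite -sE.
Qed.
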